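(* Let $X_1=X_2=X_3=[0,1]$, each $\mu_{ij}$ Lebesgue measure on $[0,1]^2$, and $c(x_1,x_2,x_3)=\max(0,x_1+x_2+3x_3-3)$. Define $f_{12}\equiv0$ on $[0,1]^2$, $f_{13}(x_1,x_3)=0$ if $x_3<\frac23$ and $f_{13}(x_1,x_3)=x_1+\frac32x_3-\frac32$ if $x_3\ge\frac23$, $f_{23}(x_2,x_3)=0$ if $x_3<\frac23$ and $f_{23}(x_2,x_3)=x_2+\frac32x_3-\frac32$ if $x_3\ge\frac23$. Then $f_{12}(x_1,x_2)+f_{13}(x_1,x_3)+f_{23}(x_2,x_3)\le c(x_1,x_2,x_3)$ on $[0,1]^3$, the tuple $\{f_{ij}\}$ maximizes $\sum_{i<j}\int f_{ij}\,d\mu_{ij}$ among all tuples of integrable functions satisfying this inequality (i.e. it solves the dual problem), and there exists a probability measure $\pi$ on $[0,1]^3$ with $\mathrm{Pr}_{ij}(\pi)=\mu_{ij}$ for all $i<j$, concentrated on $\{(x_1,x_2,x_3):x_1+x_2+3x_3\in\mathbb{Z}\}$, which minimizes $\int c\,d\pi$ among all such measures.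
   Context: $\mathrm{Pr}_{ij}$ is the projection of $[0,1]^3$ onto coordinates $(i,j)$. *)

(* Defs.v *)
From HB Require Import structures.
From mathcomp Require Import all_boot all_order all_algebra.
From mathcomp Require Import all_classical all_reals all_analysis.
Set Implicit Arguments. Unset Strict Implicit. Unset Printing Implicit Defensive.
Import Order.TTheory GRing.Theory Num.Theory.
Import numFieldNormedType.Exports.
Local Open Scope classical_set_scope.
Local Open Scope ring_scope.

Definition sq01 (R : realType) : set (R * R) :=
  [set p | p.1 \in `[0, 1] /\ p.2 \in `[0, 1]].
Definition cube01 (R : realType) : set (R * R * R) :=
  [set x | x.1.1 \in `[0, 1] /\ x.1.2 \in `[0, 1] /\ x.2 \in `[0, 1]].

(* Lebesgue measure on R^2 (product of Lebesgue measures); mu_ij is its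
   restriction to [0,1]^2. *)
Definition leb2 (R : realType) := ((@lebesgue_measure R) \x (@lebesgue_measure R))%E.

Arguments sq01 R : clear implicits.
Arguments cube01 R : clear implicits.
Arguments leb2 R : clear implicits.

Definition cost (R : realType) (x : R * R * R) : R :=
  Num.max 0 (x.1.1 + x.1.2 + 3 * x.2 - 3).

Definition f12 (R : realType) (p : R * R) : R := 0.
Definition f13 (R : realType) (p : R * R) : R :=
  if p.2 < 2 / 3 then 0 else p.1 + 3 / 2 * p.2 - 3 / 2.
Definition f23 (R : realType) (p : R * R) : R :=
  if p.2 < 2 / 3 then 0 else p.1 + 3 / 2 * p.2 - 3 / 2.

Definition pr12 (R : realType) (x : R * R * R) : R * R := (x.1.1, x.1.2).
Definition pr13 (R : realType) (x : R * R * R) : R * R := (x.1.1, x.2).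
Definition pr23 (R : realType) (x : R * R * R) : R * R := (x.1.2, x.2).

Definition admissible_plan (R : realType) (P : probability (R * R * R)%type R) : Prop :=
  P (~` (cube01 R)) = 0%E /\
  forall A : set (R * R), measurable A ->
    [/\ P (@pr12 R @^-1` A) = leb2 R (A `&` sq01 R),
        P (@pr13 R @^-1` A) = leb2 R (A `&` sq01 R) &
        P (@pr23 R @^-1` A) = leb2 R (A `&` sq01 R)].

Definition dual_feasible (R : realType) (g12 g13 g23 : R * R -> R) : Prop :=
  [/\ (leb2 R).-integrable (sq01 R) (EFin \o g12),
      (leb2 R).-integrable (sq01 R) (EFin \o g13),
      (leb2 R).-integrable (sq01 R) (EFin \o g23) &
      forall x, x \in cube01 R ->
        g12 (pr12 x) + g13 (pr13 x) + g23 (pr23 x) <= cost x].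

Definition dual_value (R : realType) (g12 g13 g23 : R * R -> R) : \bar R :=
  ((\int[leb2 R]_(p in sq01 R) (g12 p)%:E) +
   (\int[leb2 R]_(p in sq01 R) (g13 p)%:E) +
   (\int[leb2 R]_(p in sq01 R) (g23 p)%:E))%E.

(* Main.v *)
Require Import Defs.
From HB Require Import structures.
From mathcomp Require Import all_boot all_order all_algebra.
From mathcomp Require Import all_classical all_reals all_analysis.
From mathcomp Require Import measurable_realfun ring lra.
Import Order.TTheory GRing.Theory Num.Theory.
Import numFieldNormedType.Exports.
Local Open Scope classical_set_scope.
Local Open Scope ring_scope.

(* The optimal plan is the law of (x1, x2, x3) where (x1, x3) is uniform on the
   unit square and x2 is the fractional part of -(x1 + 3 x3).  For fixed x1 (resp.
   x3), the map x3 |-> x2 (resp. x1 |-> x2) wraps [0, 1] around the circle 3 times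
   (resp. once), hence preserves the Lebesgue measure; by sections, all three
   two-dimensional marginals are uniform.  On the support x1 + x2 + 3 x3 is an
   integer; if x3 < 2/3 it is < 4, hence <= 3 and the cost vanishes; if
   x3 >= 2/3 it is >= 2, hence >= 3 unless (x1, x2, x3) = (0, 0, 2/3).  So
   f12 + f13 + f23 = c almost surely, and weak duality gives the optimality of
   both the plan and the f_ij. *)

(** * Fractional parts, and the wrapping of affine maps around the circle *)

Section FractionalPart.
Local Set Implicit Arguments.
Local Unset Strict Implicit.
Context {R : realType}.
Implicit Types (x y a c : R) (A : set R).
Local Notation leb := (@lebesgue_measure R).

Definition frac_part x : R := x - (Num.floor x)%:~R.

Lemma frac_part_ge0 x : 0 <= frac_part x.
Proof. by rewrite subr_ge0 floor_le. Qed.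

Lemma frac_part_lt1 x : frac_part x < 1.
Proof. by have := floorD1_gt x; rewrite intrD /frac_part; lra. Qed.

Lemma frac_partDz x (n : int) : frac_part (x + n%:~R) = frac_part x.
Proof. by rewrite /frac_part floorDrz ?intr_int// intrKfloor intrD; lra. Qed.

Lemma frac_part_id x : 0 <= x < 1 -> frac_part x = x.
Proof.
by move=> x01; rewrite /frac_part (_ : Num.floor x = 0) ?subr0//; exact: floor_def.
Qed.

Lemma measurable_frac_part : measurable_fun setT frac_part.
Proof.
apply: measurable_funB => //; apply: nondecreasing_measurable => // x y xy.
by rewrite ler_int le_floor.
Qed.

Lemma measurable_preimage_frac_part A : measurable A -> measurable (frac_part @^-1` A).
Proof.
by move=> mA; rewrite -[X in measurable X]setTI; exact: measurable_frac_part.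
Qed.

Lemma measurable_reflect_scale a c : measurable_fun setT (fun t => a - c * t).
Proof. by apply: measurable_funB => //; exact: measurable_funM. Qed.

(** Both sides are measures in [A] that agree on the half-open intervals []x, y]], which determines
    Lebesgue measure. *)
Lemma lebesgue_measure_reflect_scale a c A : 0 < c -> measurable A ->
  leb A = (c%:E * leb ((fun t => a - c * t)%R @^-1` A))%E.
Proof.
move=> c0 mA.
have mf : measurable_fun setT
    ((fun t => a - c * t) : measurableTypeR R -> measurableTypeR R).
  exact: measurable_reflect_scale.
pose f_mix := isMeasurableFun.Build _ _ _ _ _ mf.
pose f : {mfun measurableTypeR R >-> measurableTypeR R} :=
  HB.pack (fun t => a - c * t) f_mix.
apply: (@lebesgue_measure_unique _
  (mscale (NngNum (ltW c0)) (pushforward leb f))) => //.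
move=> _ [[x y]] _ <-.
rewrite [RHS](_ : _ = (c%:E * leb (f @^-1` `]x, y]%classic))%E)//=.
have -> : f @^-1` `]x, y]%classic = `[(a - y) / c, (a - x) / c[%classic.
  by apply/seteqP; split => t /=;
    rewrite !in_itv/= ler_pdivrMr// ltr_pdivlMr//; lra.
rewrite !lebesgue_measure_itv/= !lte_fin ltr_pM2r ?invr_gt0//.
rewrite ltrD2l ltrN2; case: ifPn => _; last by rewrite mule0.
by rewrite -!EFinB -EFinM; congr EFin; field; rewrite gt_eqF.
Qed.

Lemma measurable_preimage_reflect_scale a c A : measurable A ->
  measurable ((fun t => a - c * t) @^-1` A).
Proof.
by move=> mA; rewrite -[X in measurable X]setTI; exact: measurable_reflect_scale.
Qed.

(** A translation is the composite of two reflections, t to b - t and t to -t. *)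
Lemma lebesgue_measure_translate b A : measurable A ->
  leb ((fun t => t + b) @^-1` A) = leb A.
Proof.
move=> mA; rewrite (lebesgue_measure_reflect_scale b (@ltr01 R) mA).
rewrite (lebesgue_measure_reflect_scale 0 (@ltr01 R)
  (measurable_preimage_reflect_scale b 1 mA)).
rewrite !mul1e; congr (leb _); apply/funext => t /=.
by congr A; ring.
Qed.

Lemma lebesgue_measure_itvU A x y z : measurable A -> x <= y -> y <= z ->
  leb (A `&` `]x, z]) = (leb (A `&` `]x, y]) + leb (A `&` `]y, z]))%E.
Proof.
move=> mA xy yz; rewrite -measureU//; try exact: measurableI.
  rewrite -setIUr; congr (leb (A `&` _)); apply/seteqP; split => t /=;
    rewrite !in_itv/=; last by lra.
  by case: (lerP t y) => ty ?; [left|right]; lra.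
by rewrite -subset0 => t [[_ /=]] + [_ /=]; rewrite !in_itv/=; lra.
Qed.

(** With n the floor of a, cut []a, a + 1]] at n + 1 and move the right piece back by 1: the two
    pieces then tile []n, n + 1]], an integer translate of []0, 1]]. *)
Lemma lebesgue_measure_frac_period a A : measurable A ->
  leb (frac_part @^-1` A `&` `]a, a + 1]) = leb (frac_part @^-1` A `&` `]0, 1]).
Proof.
move=> mA; have mF := measurable_preimage_frac_part mA.
have mFI x y : measurable (frac_part @^-1` A `&` `]x, y]) by exact: measurableI.
have shift x y (n : int) : leb (frac_part @^-1` A `&` `]x + n%:~R, y + n%:~R]) =
    leb (frac_part @^-1` A `&` `]x, y]).
  rewrite -(lebesgue_measure_translate n%:~R (mFI (x + n%:~R) (y + n%:~R))).
  by congr (leb _); apply/seteqP; split => t /=;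
    rewrite !in_itv/= frac_partDz lerD2r ltrD2r.
pose n := Num.floor a.
have na : n%:~R <= a := floor_le a.
have an : a < n%:~R + 1 by have := floorD1_gt a; rewrite intrD.
rewrite (@lebesgue_measure_itvU _ a (n%:~R + 1)) ?lerD2r//; last exact: ltW.
rewrite (shift (n%:~R) a 1) addeC -lebesgue_measure_itvU//; last exact: ltW.
by rewrite -(shift 0 1 n) add0r addrC.
Qed.

Lemma lebesgue_measure_frac_itv a (k : nat) A : measurable A ->
  leb (frac_part @^-1` A `&` `]a, a + k%:R]) =
  (k%:R%:E * leb (frac_part @^-1` A `&` `]0%R, 1%R]))%E.
Proof.
move=> mA; elim: k => [|k IHk].
  by rewrite addr0 set_itvoc0 setI0 measure0 mul0e.
rewrite (@lebesgue_measure_itvU _ _ (a + k%:R)) ?lerDl ?lerD2l ?ler_nat//.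
  rewrite IHk -natr1 addrA lebesgue_measure_frac_period// EFinD.
  by rewrite ge0_muleDl ?lee_fin// mul1e.
exact: measurable_preimage_frac_part.
Qed.

(** Serves to ignore the endpoints 0 and 1 when closed and half-open intervals are exchanged. *)
Lemma measure_setD_null d (T : measurableType d)
    (mu : {measure set T -> \bar R}) (N A B : set T) : measurable A ->
  measurable B -> measurable N -> mu N = 0%E -> A `\` N = B `\` N ->
  mu A = mu B.
Proof.
move=> mA mB mN N0 AB; rewrite -(measureU0 mA mN N0) -(measureU0 mB mN N0).
have UD (C : set T) : C `|` N = C `\` N `|` N by rewrite setUDl setDv setD0.
by rewrite UD AB -UD.
Qed.

(** The affine map stretches [[0, 1]] by k onto an interval made of k full periods; the k-fold
    covering cancels the factor 1/k from the scaling. *)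
Lemma lebesgue_measure_frac_reflect_scale a (k : nat) A : (0 < k)%N ->
  measurable A ->
  leb ((fun t => frac_part (a - k%:R * t)) @^-1` A `&` `[0, 1]) = leb (A `&` `[0, 1]).
Proof.
move=> k0 mA; have mF := measurable_preimage_frac_part mA.
have kp : 0 < k%:R :> R by rewrite ltr0n.
have mN : measurable [set 0; 1 : R].
  by apply: measurableU; exact: measurable_set1.
have N0 : leb [set 0; 1 : R] = 0%E.
  by apply: countable_lebesgue_measure0; exact/finite_set_countable/finite_set2.
have mFa x y : measurable (frac_part @^-1` A `&` `]x, y]) by exact: measurableI.
have open01 (t : R) : t <> 0 -> t <> 1 -> 0 <= t <= 1 -> 0 < t < 1.
  by move=> /eqP t0 /eqP t1; rewrite [0 < t]lt_neqAle [t < 1]lt_neqAle eq_sym t0 t1.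
(* Up to the endpoints, [[0, 1]] is the preimage of []a - k, a]], here written as an interval of
   length k. *)
transitivity (leb ((fun t => a - k%:R * t) @^-1`
    (frac_part @^-1` A `&` `]a - k%:R, a - k%:R + k%:R]))).
  apply: (@measure_setD_null _ _ leb [set 0; 1]).
- apply: measurableI => //.
  exact: (measurable_preimage_reflect_scale a k%:R mF).
- exact: measurable_preimage_reflect_scale.
- exact: mN.
- exact: N0.
- apply/seteqP; split => t /= [[At]]; rewrite !in_itv/= => t01 /not_orP[t0 t1].
  + have {}t01 := open01 _ t0 t1 t01.
    split; last exact/not_orP.
    by split=> //; apply/andP; split; nra.
  + split; last exact/not_orP.
    by split=> //; apply/andP; split; nra.
have := lebesgue_measure_reflect_scale a kp (mFa (a - k%:R) (a - k%:R + k%:R)).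
rewrite lebesgue_measure_frac_itv// => /(congr1 (fun z => (k%:R^-1)%:E * z)%E).
rewrite !muleA -!EFinM mulVf ?gt_eqF// !mul1e => <-.
(* On the open unit interval [frac_part] is the identity, so only the endpoints have to be
   discarded. *)
apply: (@measure_setD_null _ _ leb [set 0; 1]) => //; try exact: measurableI.
apply/seteqP; split => t /= [[At]]; rewrite !in_itv/= => t01 /not_orP[t0 t1];
  have /andP[t_gt0 t_lt1] : 0 < (t : R) < 1 by
    apply: open01 => //; case/andP: t01 => t01 ->; rewrite ?t01 ?ltW.
- split; last exact/not_orP.
  by split; [rewrite -(@frac_part_id t)// t_lt1 ltW|rewrite !ltW].
- split; last exact/not_orP.
  by split; [rewrite frac_part_id// t_lt1 ltW|rewrite t_gt0 ltW].
Qed.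

End FractionalPart.

(** * Construction of the plan and its two-dimensional marginals *)

Section UniformCoupling.
Local Set Implicit Arguments.
Local Unset Strict Implicit.
Context {R : realType}.
Implicit Types A B : set (R * R).
Local Notation leb := (@lebesgue_measure R).

Lemma sq01E : sq01 R = `[0, 1] `*` `[0, 1].
Proof. by apply/seteqP; split. Qed.

Lemma measurable_sq01 : measurable (sq01 R).
Proof. by rewrite sq01E; exact: measurableX. Qed.

Lemma leb2_sq01 : leb2 R (sq01 R) = 1%E.
Proof.
rewrite sq01E [LHS]product_measure1E//= lebesgue_measure_itv/= lte_fin ltr01.
by rewrite oppr0 adde0 mule1.
Qed.

(** Tonelli for sets: [leb2] is built from x-sections, and uniqueness of the product measure permits
    slicing in the other order. *)
Lemma leb2_ysection A : measurable A ->
  leb2 R A = (\int[leb]_y leb (ysection A y))%E.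
Proof.
move=> mA; rewrite -[RHS]/((leb \x^ leb)%E A).
by apply: product_measure_unique => //= *; rewrite product_measure2E.
Qed.

Lemma eq_leb2_xsection A B : (forall x, leb (xsection A x) = leb (xsection B x)) ->
  leb2 R A = leb2 R B.
Proof. by move=> AB; apply: eq_integral => x _ /=. Qed.

Lemma eq_leb2_ysection A B : measurable A -> measurable B ->
  (forall y, leb (ysection A y) = leb (ysection B y)) ->
  leb2 R A = leb2 R B.
Proof.
by move=> mA mB AB; rewrite !leb2_ysection//; apply: eq_integral => x _ /=.
Qed.

(** The pair [p] stands for (x1, x3); the middle entry is the only x2 in [0, 1) that makes x1 + x2 +
    3 x3 an integer. *)
Definition lift_plan (p : R * R) : R * R * R :=
  (p.1, frac_part (- (p.1 + 3 * p.2)), p.2).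

Lemma measurable_lift_plan : measurable_fun setT lift_plan.
Proof.
apply: measurable_fun_pair => //; apply: measurable_fun_pair => //.
apply: (measurableT_comp measurable_frac_part); apply: measurable_funN.
by apply: measurable_funD => //; exact: measurable_funM.
Qed.

Lemma measurable_pr12 : measurable_fun setT (@pr12 R).
Proof. by apply: measurable_fun_pair; exact: measurableT_comp. Qed.

Lemma measurable_pr13 : measurable_fun setT (@pr13 R).
Proof. by apply: measurable_fun_pair => //; exact: measurableT_comp. Qed.

Lemma measurable_pr23 : measurable_fun setT (@pr23 R).
Proof. by apply: measurable_fun_pair => //; exact: measurableT_comp. Qed.

(** Slice at fixed x1: there x3 is sent to x2 by a wrapped affine map with k = 3. *)
Lemma leb2_lift_plan12 A : measurable A ->
  leb2 R ((@pr12 R \o lift_plan) @^-1` A `&` sq01 R) = leb2 R (A `&` sq01 R).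
Proof.
move=> mA; apply: eq_leb2_xsection => x.
have [x01|x01] := boolP (x \in `[0, 1]); last first.
  congr (leb _); apply/seteqP; split => y; rewrite /xsection/= !inE/= => -[_ []].
    by rewrite (negbTE x01).
  by rewrite (negbTE x01).
transitivity (leb ((fun t => frac_part (- x - 3 * t)) @^-1` xsection A x `&` `[0, 1])).
  congr (leb _); apply/seteqP; split => y; rewrite /xsection/= !inE/= /pr12/= -opprD.
    by move=> [? []].
  by move=> [].
rewrite lebesgue_measure_frac_reflect_scale//; last exact: measurable_xsection.
congr (leb _); apply/seteqP; split => y; rewrite /xsection/= !inE/=.
  by move=> [].
by move=> [? []].
Qed.

(** Slice at fixed x3: there x1 is sent to x2 by a wrapped reflection, the case k = 1. *)
Lemma leb2_lift_plan23 A : measurable A ->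
  leb2 R ((@pr23 R \o lift_plan) @^-1` A `&` sq01 R) = leb2 R (A `&` sq01 R).
Proof.
move=> mA; apply: eq_leb2_ysection => [||y].
- apply: measurableI; last exact: measurable_sq01.
  rewrite -[X in measurable X]setTI.
  exact: (measurableT_comp measurable_pr23 measurable_lift_plan).
- by apply: measurableI => //; exact: measurable_sq01.
have [y01|y01] := boolP (y \in `[0, 1]); last first.
  congr (leb _); apply/seteqP; split => x; rewrite /ysection/= !inE/= => -[_ []] _.
    by rewrite /= (negbTE y01).
  by rewrite /= (negbTE y01).
transitivity (leb ((fun t => frac_part (- (3 * y) - 1%:R * t)) @^-1`
    ysection A y `&` `[0, 1])).
  congr (leb _); apply/seteqP; split => x;
    rewrite /ysection/= !inE/= /pr23/= mul1r -opprD addrC.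
    by move=> [? []].
  by move=> [].
rewrite lebesgue_measure_frac_reflect_scale//; last exact: measurable_ysection.
congr (leb _); apply/seteqP; split => x; rewrite /ysection/= !inE/=.
  by move=> [].
by move=> [? []].
Qed.

(** The pushforward under [lift_plan] of Lebesgue measure on the square, unfolded to a plain set
    function; its measure axioms come from [plan_measure]. *)
Definition plan (A : set (R * R * R)) : \bar R :=
  leb2 R (lift_plan @^-1` A `&` sq01 R).

Let plan_measure : {measure set (R * R * R) -> \bar R} :=
  @measure_function_pushforward__canonical__measure_function_Measure _ _ _ _ _
    (mrestr (leb2 R) measurable_sq01) lift_plan measurable_lift_plan.

Let plan0 : plan set0 = 0%E.
Proof. exact: (measure0 plan_measure). Qed.

Let plan_ge0 U : (0 <= plan U)%E.
Proof. exact: (measure_ge0 plan_measure). Qed.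

Let plan_sigma_additive : semi_sigma_additive plan.
Proof. exact: (@measure_semi_sigma_additive _ _ _ plan_measure). Qed.

HB.instance Definition _ := isMeasure.Build _ _ _ plan
  plan0 plan_ge0 plan_sigma_additive.

Let plan_setT : plan setT = 1%E.
Proof. by rewrite /plan preimage_setT setTI leb2_sq01. Qed.

HB.instance Definition _ := Measure_isProbability.Build _ _ _ plan plan_setT.

End UniformCoupling.

(** * Admissibility of the plan, and comparison of the dual functions with the cost *)

Section Duality.
Local Set Implicit Arguments.
Local Unset Strict Implicit.
Context {R : realType}.
Implicit Types (P Q : probability (R * R * R)%type R) (g : R * R -> R).

Lemma measurable_cube01 : measurable (cube01 R).
Proof.
have -> : cube01 R = (`[0, 1] `*` `[0, 1]) `*` `[0, 1].
  by apply/seteqP; split => [x [? []]|x [[]]].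
by do 2?apply: measurableX.
Qed.

Lemma admissible_plan_plan : admissible_plan (plan : probability _ R).
Proof.
split.
  rewrite -[LHS]/(leb2 R (lift_plan @^-1` (~` cube01 R) `&` sq01 R)).
  rewrite (_ : _ `&` _ = set0) ?[LHS]measure0//.
  apply/seteqP; split => // p [] /= + [? ?]; apply; split => //; split => //=.
  by rewrite in_itv/= frac_part_ge0 ltW// frac_part_lt1.
move=> A mA; split; first exact: leb2_lift_plan12.
  (* [lift_plan] keeps x1 and x3, so this marginal is uniform by construction. *)
  rewrite -[LHS]/(leb2 R (lift_plan @^-1` (@pr13 R @^-1` A) `&` sq01 R)).
  by congr (leb2 R _); apply/seteqP; split => -[].
exact: leb2_lift_plan23.
Qed.

(** On the image of [lift_plan] the sum is minus the floor of -(x1 + 3 x3), so the exceptional set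
    has empty preimage. *)
Lemma plan_int :
  plan (~` [set x | x.1.1 + x.1.2 + 3 * x.2 \is a @Num.int R]) = 0%E.
Proof.
rewrite /plan (_ : _ `&` _ = set0) ?[LHS]measure0//.
apply/seteqP; split => // p [] /= + _; apply.
rewrite (_ : _ + _ = - (Num.floor (- (p.1 + 3 * p.2)))%:~R).
  by rewrite rpredN intr_int.
by rewrite /frac_part; ring.
Qed.

Lemma measurable_set_pair1 (p : R * R) : measurable [set p].
Proof.
rewrite (_ : [set p] = [set p.1] `*` [set p.2]); first exact: measurableX.
by apply/seteqP; split => -[x y] /=; case: p => ? ? /= [-> ->].
Qed.

Lemma plan_pr13_point (p : R * R) : plan (@pr13 R @^-1` [set p]) = 0%E.
Proof.
have mp := measurable_set_pair1 p.
have [_ /(_ _ mp)[_ -> _]] := admissible_plan_plan.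
apply/eqP; rewrite eq_le measure_ge0 andbT.
apply: (@le_trans _ _ (leb2 R ([set p.1] `*` setT))).
  apply: le_measure; rewrite ?inE; [|exact: measurableX|by move=> ? [-> _]].
  by apply: measurableI => //; exact: measurable_sq01.
by rewrite [leLHS]product_measure1E//= lebesgue_measure_set1 mul0e.
Qed.

(** The left side is 0 when x3 < 2/3 and x1 + x2 + 3 x3 - 3 otherwise: in each case one of the two
    arguments of the maximum. *)
Lemma f_le_cost x : f12 (pr12 x) + f13 (pr13 x) + f23 (pr23 x) <= @cost R x.
Proof.
rewrite /f12 /f13 /f23 /cost /=; case: ifP => _; rewrite le_max.
  by rewrite !addr0 lexx.
by apply/orP; right; lra.
Qed.

(** At (0, 0, 2/3) the left side is -1 and the cost 0. The exclusion is stated on (x1, x3) so that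
    the 13-marginal shows it to be negligible. *)
Lemma f_eq_cost x : x \in cube01 R -> x.1.1 + x.1.2 + 3 * x.2 \is a Num.int ->
  pr13 x <> (0, 2 / 3) ->
  f12 (pr12 x) + f13 (pr13 x) + f23 (pr23 x) = @cost R x.
Proof.
case: x => -[x y] z; rewrite inE /cube01/= !in_itv/=.
move=> -[x01 [y01 z01]] /intrP[n sn] xz.
rewrite /f12 /f13 /f23 /cost /=; case: ltP => z23.
  have : n < 3 + 1 by rewrite -(ltr_int R) -sn; lra.
  rewrite ltzD1 -(ler_int R) -sn => n3.
  by rewrite !addr0 max_l//; lra.
have : 2 <= n by rewrite -(ler_int R) -sn; lra.
rewrite le_eqVlt => /orP[/eqP n2|].
  (* A sum equal to 2 with x3 >= 2/3 forces x1 = x2 = 0 and x3 = 2/3. *)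
  move: sn; rewrite -n2 => s2; exfalso; apply: xz.
  by congr pair => /=; lra.
rewrite -lezD1 -(ler_int R) -sn => n3.
by rewrite max_r; lra.
Qed.

Lemma integrable_f13 : (leb2 R).-integrable (sq01 R) (EFin \o @f13 R).
Proof.
apply: measurable_bounded_integrable.
- exact: measurable_sq01.
- by rewrite [ltLHS]leb2_sq01 ltry.
- apply: measurable_funTS; apply: measurable_fun_ifT => //.
    exact: measurable_fun_ltr.
  apply: measurable_funB => //; apply: measurable_funD => //.
  exact: measurable_funM.
exists 3; split => // M M3 [x y] [/=]; rewrite !in_itv/= /f13/= => x01 y01.
by case: ifP => _; rewrite ?normr0 ?ler_norml; lra.
Qed.

Lemma dual_feasible_f : dual_feasible (@f12 R) (@f13 R) (@f23 R).
Proof.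
(* [f13] and [f23] are the same function of a pair, so one integrability proof serves both. *)
split; [|exact: integrable_f13|exact: integrable_f13|by move=> x _; exact: f_le_cost].
exact: integrable0.
Qed.

(** * Change of variables from a plan to one of its marginals *)

Section Marginal.
(* [leb2] lives on this copy of [R * R], whose measurable sets are those of
   [R * R] but whose measure display differs. *)
Local Notation R2 := (measurableTypeR R * measurableTypeR R)%type.
Variables (Q : probability (R * R * R)%type R) (pr : R * R * R -> R2).
Hypotheses (mpr : measurable_fun setT pr) (Qcube : Q (~` cube01 R) = 0%E).
Hypothesis (Qpr : forall A, measurable A -> Q (pr @^-1` A) = leb2 R (A `&` sq01 R)).
Hypothesis pr_sq : cube01 R `<=` pr @^-1` sq01 R.

Lemma marginal_integral (g : R2 -> R) : (leb2 R).-integrable (sq01 R) (EFin \o g) ->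
  Q.-integrable (cube01 R) (EFin \o g \o pr) /\
  (\int[Q]_(x in cube01 R) (g (pr x))%:E =
   \int[leb2 R]_(p in sq01 R) (g p)%:E)%E.
Proof.
(* [g] is controlled on the square only; its extension by zero is measurable everywhere, so
   composing it with [pr] is safe. *)
move=> ig; pose h : R2 -> \bar R := (EFin \o g) \_ (sq01 R).
have mh : measurable_fun setT h.
  apply/(measurable_restrictT _ measurable_sq01).
  exact: (measurable_int (leb2 R)).
have eqQ (F : R2 -> \bar R) :
    (\int[pushforward Q pr]_(p in sq01 R) F p = \int[leb2 R]_(p in sq01 R) F p)%E.
  apply: eq_measure_integral => A mA sA.
  by rewrite -[LHS]/(Q (pr @^-1` A)) Qpr// setIidl.
have ih : (leb2 R).-integrable (sq01 R) h.
  apply: eq_integrable ig => [|p psq]; first exact: measurable_sq01.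
  by rewrite /h patchE psq.
have ihpr : Q.-integrable (pr @^-1` sq01 R) (h \o pr).
  apply/integrableP; split; first exact/measurable_funTS/measurableT_comp.
  rewrite -(@ge0_integral_pushforward _ _ _ _ _ _ mpr Q _ (abse \o h))//.
  - by rewrite eqQ; case/integrableP : ih.
  - exact: measurable_sq01.
  - exact/measurable_funTS/measurableT_comp.
  - by move=> p _; exact: abse_ge0.
have mprsq : measurable (pr @^-1` sq01 R).
  by rewrite -[X in measurable X]setTI; apply: mpr => //; exact: measurable_sq01.
have hE : {in cube01 R, h \o pr =1 EFin \o g \o pr}.
  by move=> x /set_mem/pr_sq xsq; rewrite /h/= patchE ifT// inE.
split.
  apply: (eq_integrable measurable_cube01 _ _ hE).
  exact: (integrableS mprsq measurable_cube01 pr_sq).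
transitivity (\int[leb2 R]_(p in sq01 R) h p)%E; last first.
  by apply: eq_integral => p psq; rewrite /h patchE psq.
rewrite -eqQ.
rewrite (integral_pushforward mpr)//; last exact: measurable_sq01.
(* The preimage of the square may be larger than the cube, but the excess is null for [Q]. *)
rewrite (@negligible_integral _ _ _ _ _ (~` cube01 R))//; last first.
  by apply: measurableC; exact: measurable_cube01.
rewrite setDE setCK (setIidr pr_sq).
by apply: eq_integral => x xc; rewrite hE.
Qed.

End Marginal.

(** The dual value sees only the marginals, so it can be computed as one integral against any
    admissible plan. *)
Lemma dual_value_integral Q g12 g13 g23 : admissible_plan Q ->
  dual_feasible g12 g13 g23 ->
  Q.-integrable (cube01 R)
    (fun x => (g12 (pr12 x) + g13 (pr13 x) + g23 (pr23 x))%:E) /\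
  dual_value g12 g13 g23 =
  (\int[Q]_(x in cube01 R) (g12 (pr12 x) + g13 (pr13 x) + g23 (pr23 x))%:E)%E.
Proof.
move=> [Q0 QA] [i12 i13 i23 _].
have sq12 : cube01 R `<=` @pr12 R @^-1` sq01 R by move=> x [? []].
have sq13 : cube01 R `<=` @pr13 R @^-1` sq01 R by move=> x [? []].
have sq23 : cube01 R `<=` @pr23 R @^-1` sq01 R by move=> x [? []].
have [j12 e12] := marginal_integral measurable_pr12 Q0
  (fun A mA => let: And3 q _ _ := QA A mA in q) sq12 i12.
have [j13 e13] := marginal_integral measurable_pr13 Q0
  (fun A mA => let: And3 _ q _ := QA A mA in q) sq13 i13.
have [j23 e23] := marginal_integral measurable_pr23 Q0
  (fun A mA => let: And3 _ _ q := QA A mA in q) sq23 i23.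
have mc := measurable_cube01.
have j := integrableD mc (integrableD mc j12 j13) j23.
split; first exact: j.
rewrite /dual_value -e12 -e13 -e23.
by rewrite -(integralD mc j12 j13) -(integralD mc (integrableD mc j12 j13) j23).
Qed.

(** * Integrability of the cost, weak duality and absence of a duality gap *)

Lemma measurable_cost : measurable_fun setT (@cost R).
Proof.
apply: measurable_maxr => //; apply: measurable_funB => //.
apply: measurable_funD.
  by apply: measurable_funD; apply: measurableT_comp.
exact: measurable_funM.
Qed.

Lemma integral_cost_cube01 Q : admissible_plan Q ->
  (\int[Q]_x (cost x)%:E = \int[Q]_(x in cube01 R) (cost x)%:E)%E.
Proof.
move=> [Q0 _]; rewrite (@ge0_negligible_integral _ _ _ _ _ (~` cube01 R))//.
- by rewrite setDE setTI setCK.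
- by apply: measurableC; exact: measurable_cube01.
- by apply/measurable_EFinP; exact: measurable_cost.
- by move=> x _; rewrite lee_fin le_max lexx.
Qed.

Lemma integrable_cost Q : Q.-integrable (cube01 R) (EFin \o @cost R).
Proof.
apply: measurable_bounded_integrable.
- exact: measurable_cube01.
- exact: le_lt_trans (probability_le1 Q measurable_cube01) (ltry _).
- by apply: measurable_funTS; exact: measurable_cost.
exists 3; split => // M M3 [[x y] z] [/= + []].
rewrite !in_itv/= /cost/= => x01 y01 z01.
rewrite ger0_norm ?le_max ?lexx// ge_max; apply/andP; split; lra.
Qed.

(** Weak duality: integrate the feasibility inequality against [Q]. *)
Lemma dual_le_primal Q g12 g13 g23 : admissible_plan Q ->
  dual_feasible g12 g13 g23 ->
  (dual_value g12 g13 g23 <= \int[Q]_x (cost x)%:E)%E.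
Proof.
move=> aQ fg; have [ig ->] := dual_value_integral aQ fg.
rewrite integral_cost_cube01//; apply: le_integral => //.
- exact: measurable_cube01.
- exact: integrable_cost.
by move=> x xc; rewrite lee_fin; have [_ _ _] := fg; exact.
Qed.

(** No duality gap: the feasibility inequality is an equality almost everywhere for [plan]. *)
Lemma dual_value_f : (dual_value (@f12 R) (@f13 R) (@f23 R) =
  \int[plan]_x (cost x)%:E)%E.
Proof.
have aP := admissible_plan_plan.
have [ig ->] := dual_value_integral aP dual_feasible_f.
rewrite integral_cost_cube01//; apply: ae_eq_integral.
- exact: measurable_cube01.
- exact: measurable_int ig.
- apply/measurable_EFinP; apply: measurable_funTS; exact: measurable_cost.
pose sum3 (x : R * R * R) := x.1.1 + x.1.2 + 3 * x.2.
have aeint : {ae plan, forall x, sum3 x \is a Num.int}.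
  exists (~` [set x | sum3 x \is a Num.int]); split=> //; last exact: plan_int.
  (* Being an integer means having fractional part 0, which exhibits the set as measurable. *)
  have -> : [set x | sum3 x \is a Num.int] = (frac_part \o sum3) @^-1` [set 0].
    apply/seteqP; split => x /=; rewrite /frac_part intrEfloor.
      by move=> /eqP ->; rewrite subrr.
    by move=> /subr0_eq <-.
  apply: measurableC; rewrite -[X in measurable X]setTI.
  suff msum : measurable_fun setT sum3.
    exact: (measurableT_comp measurable_frac_part msum).
  apply: measurable_funD; last exact: measurable_funM.
  by apply: measurable_funD; apply: measurableT_comp.
have aept : {ae plan, forall x, @pr13 R x <> (0, 2 / 3)}.
  exists (@pr13 R @^-1` [set (0, 2 / 3)]); split; last by move=> x /= /contrapT.
    rewrite -[X in measurable X]setTI; apply: measurable_pr13 => //.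
    exact: measurable_set_pair1.
  exact: plan_pr13_point.
apply: filterS2 aeint aept => x xint xpt xc; congr EFin.
by apply: f_eq_cost => //; exact: mem_set.
Qed.

End Duality.

Theorem mainTheorem19 (R : realType) :
  (forall x, x \in cube01 R ->
     f12 (pr12 x) + f13 (pr13 x) + f23 (pr23 x) <= cost x) /\
  (dual_feasible (@f12 R) (@f13 R) (@f23 R) /\
   forall g12 g13 g23 : R * R -> R, dual_feasible g12 g13 g23 ->
     (dual_value g12 g13 g23 <= dual_value (@f12 R) (@f13 R) (@f23 R))%E) /\
  exists P : probability (R * R * R)%type R,
    [/\ admissible_plan P,
        P (~` [set x | x.1.1 + x.1.2 + 3 * x.2 \is a Num.int]) = 0%E &
        forall Q : probability (R * R * R)%type R, admissible_plan Q ->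
          (\int[P]_x (cost x)%:E <= \int[Q]_x (cost x)%:E)%E].
Proof.
split; [by move=> x _; exact: f_le_cost|split].
  split; [exact: dual_feasible_f|move=> g12 g13 g23 fg].
  (* The cost of [plan] bounds every dual value and is attained by the given functions; the same
     equality below makes it the least primal cost. *)
  by rewrite dual_value_f; exact: dual_le_primal admissible_plan_plan fg.
exists plan; split; [exact: admissible_plan_plan|exact: plan_int|move=> Q aQ].
by rewrite -dual_value_f; exact: dual_le_primal aQ dual_feasible_f.
Qed.
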